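(* Let $N\geq 1$ be an integer, let $m \leq M$ be real numbers, let $B_N^{(m,M)}$ be the modified Bernstein operator with respect to the lower bound $m$ and the upper bound $M$, and let $u:[-1,1]\to\mathbb{R}$ be some function. Then $$m \leq B_N^{(m,M)}[u](x) \leq M \quad \text{for all } x \in [-1,1].$$
   Context: On the interval $[-1,1]$ the Bernstein basis polynomials of degree $N$ are $$b_{n,N}(x) = \binom{N}{n} \frac{(x+1)^n (1-x)^{N-n}}{2^N}, \quad n=0,\dots,N.$$ The modified Bernstein operator (modified Bernstein reconstruction) with respect to the lower bound $m$ and the upper bound $M$ maps a function $u:[-1,1]\to\mathbb{R}$ to the polynomial $$B_N^{(m,M)}[u](x) = \sum_{n=0}^N \beta_n b_{n,N}(x),$$ where $\beta_n = u\left(-1+2\frac{n}{N}\right)$ if $m \leq u\left(-1+2\frac{n}{N}\right) \leq M$, $\beta_n = m$ if $u\left(-1+2\frac{n}{N}\right) < m$, and $\beta_n = M$ if $u\left(-1+2\frac{n}{N}\right) > M$. *)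

(* Defs.v *)
From HB Require Import structures.
From mathcomp Require Import all_boot all_order all_algebra.
From mathcomp Require Import reals.

Set Implicit Arguments.
Unset Strict Implicit.
Unset Printing Implicit Defensive.

Import Order.TTheory GRing.Theory Num.Theory.
Local Open Scope ring_scope.

Definition bernstein_basis (R : realType) (N n : nat) : {poly R} :=
  ('C(N, n)%:R / 2 ^+ N) *: (('X + 1) ^+ n * (1 - 'X) ^+ (N - n)).

Definition sym_itv (R : realType) : Type := {x : R | x \in `[-1, 1]}.

(* No side condition on N: for N = 0 the quotient n / N is 0. *)
Lemma bernstein_node_subproof (R : realType) (N : nat) (n : 'I_N.+1) :
  -1 + 2 * (n%:R / N%:R) \in `[(-1 : R), 1].
Proof.
have h0 : 0 <= n%:R / N%:R :> R by rewrite divr_ge0 ?ler0n.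
have h1 : n%:R / N%:R <= 1 :> R.
  case: N n h0 => [|N] n _; first by rewrite invr0 mulr0 ler01.
  by rewrite ler_pdivrMr ?ltr0n // mul1r ler_nat -ltnS ltn_ord.
rewrite in_itv /= lerDl mulr_ge0 ?ler0n //= addrC lerBlDr -[1 + 1]/(2 : R).
by rewrite -[leRHS]mulr1 ler_wpM2l ?ler0n.
Qed.

Definition bernstein_node (R : realType) (N : nat) (n : 'I_N.+1) : sym_itv R :=
  exist _ (-1 + 2 * (n%:R / N%:R)) (bernstein_node_subproof R n).

(* For m <= M the final branch is exactly the case M < y. *)
Definition modified_coef (R : realType) (m M : R) (u : sym_itv R -> R)
    (N : nat) (n : 'I_N.+1) : R :=
  let y := u (bernstein_node R n) in
  if m <= y <= M then y else if y < m then m else M.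

Definition modified_bernstein (R : realType) (m M : R) (N : nat)
    (u : sym_itv R -> R) : {poly R} :=
  \sum_(n < N.+1) modified_coef m M u n *: bernstein_basis R N n.

(* Main.v *)
Require Import Defs.
From HB Require Import structures.
From mathcomp Require Import all_boot all_order all_algebra.
From mathcomp Require Import reals.

Import Order.TTheory GRing.Theory Num.Theory.
Local Open Scope ring_scope.

(** At each point of [-1, 1] the Bernstein basis polynomials of degree [N] are
    nonnegative weights ([bernstein_basis_ge0]) that add up to 1
    ([sum_bernstein_basis]), so the modified Bernstein polynomial takes there
    a weighted average of its coefficients. Truncation puts every coefficient
    between [m] and [M] ([modified_coef_itv]), and an average of numbers in an
    interval stays in it ([convex_sum_itv]). *)

Lemma horner_bernstein_basis (R : realType) (N n : nat) (x : R) :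
  (bernstein_basis R N n).[x] =
  'C(N, n)%:R / 2 ^+ N * ((x + 1) ^+ n * (1 - x) ^+ (N - n)).
Proof. by rewrite /bernstein_basis !hornerE. Qed.

Lemma bernstein_basis_ge0 (R : realType) (N n : nat) (x : R) :
  x \in `[-1, 1] -> 0 <= (bernstein_basis R N n).[x].
Proof.
rewrite in_itv /= => /andP[x_ge x_le]; rewrite horner_bernstein_basis.
apply: mulr_ge0; first by rewrite divr_ge0 ?exprn_ge0 ?ler0n.
by rewrite mulr_ge0 ?exprn_ge0 ?subr_ge0 // -lerBlDr sub0r.
Qed.

(** The binomial expansion of [((1 - x) + (x + 1)) ^+ N = 2 ^+ N], divided by
    [2 ^+ N]. *)
Lemma sum_bernstein_basis (R : realType) (N : nat) (x : R) :
  \sum_(n < N.+1) (bernstein_basis R N n).[x] = 1.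
Proof.
have two_neq0 : (2 : R) ^+ N != 0 by rewrite expf_neq0 ?pnatr_eq0.
apply: (mulfI two_neq0); rewrite mulr1 mulr_sumr.
have {2}-> : 2 = (1 - x) + (x + 1) :> R by rewrite addrA subrK.
rewrite [RHS]exprDn; apply: eq_bigr => n _; rewrite horner_bernstein_basis.
by rewrite mulrA [2 ^+ N * _]mulrC divfK // mulr_natl [_ ^+ n * _]mulrC.
Qed.

Lemma modified_coef_itv (R : realType) (m M : R) (u : sym_itv R -> R) (N : nat)
    (n : 'I_N.+1) :
  m <= M -> m <= modified_coef m M u n <= M.
Proof.
move=> le_mM; rewrite /modified_coef; case: ifP => // _.
by case: ifP => _; rewrite lexx le_mM.
Qed.

Lemma convex_sum_itv (R : numDomainType) (I : finType) (w c : I -> R)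
    (a b : R) :
  (forall i, 0 <= w i) -> \sum_i w i = 1 -> (forall i, a <= c i <= b) ->
  a <= \sum_i c i * w i <= b.
Proof.
move=> w_ge0 w_sum1 c_itv.
have avg z : z = \sum_i z * w i by rewrite -mulr_sumr w_sum1 mulr1.
by rewrite [a]avg [b]avg; apply/andP; split; apply: ler_sum => i _;
  apply: ler_wpM2r => //; case/andP: (c_itv i).
Qed.

Theorem theorem4 (R : realType) (N : nat) (m M : R) (u : sym_itv R -> R)
    (hN : (1 <= N)%N) (hmM : m <= M) :
  forall x : R, x \in `[-1, 1] ->
    m <= (modified_bernstein m M N u).[x] <= M.
Proof.
move=> x x_itv; rewrite /modified_bernstein horner_sum.
under eq_bigr do rewrite hornerZ.
apply: convex_sum_itv => [n||n].
- exact: bernstein_basis_ge0.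
- exact: sum_bernstein_basis.
- exact: modified_coef_itv.
Qed.
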